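(* Let $V$ be a Jordan superalgebra over a field $\mathbb{K}$ of characteristic different from $2$ and $3$, such that $L_x\notin\mathrm{Der}(V)$ for all nonzero $x\in V$. Then, as Lie superalgebras, $$\widetilde{\mathfrak{istr}}(V)\cong\mathrm{Inn}(V,V).$$ In particular, for a unital Jordan superalgebra $V$ one has $\widetilde{\mathfrak{istr}}(V)\cong\mathfrak{istr}(V)$.
   Context: $\mathbb{K}$ is a field of characteristic $\neq 2,3$. Super vector spaces $V=V_{\bar 0}\oplus V_{\bar 1}$ are not assumed finite dimensional; $|x|\in\mathbb{Z}/2\mathbb{Z}$ is the parity of a homogeneous $x$; formulas with signs are for homogeneous elements and extended linearly; $[A,B]=AB-(-1)^{|A||B|}BA$ is the supercommutator on $\mathrm{End}(V)$, and $\mathfrak{gl}(V)$ is $\mathrm{End}(V)$ with this bracket. A Jordan superalgebra is a super vector space $V$ with a bilinear product satisfying $V_iV_j\subset V_{i+j}$, $xy=(-1)^{|x||y|}yx$, and $(-1)^{|x||z|}[L_x,L_{yz}]+(-1)^{|y||x|}[L_y,L_{zx}]+(-1)^{|z||y|}[L_z,L_{xy}]=0$, where $L_x(y)=xy$. It is unital if there is $e\in V$ with $ex=x=xe$ for all $x$. $\mathrm{Der}(V)$ is the space of derivations, i.e. (spanned by homogeneous) $D\in\mathrm{End}(V)$ with $D(xy)=D(x)y+(-1)^{|x||D|}xD(y)$; $\mathrm{Inn}(V)\subset\mathrm{Der}(V)$ is the linear span of the operators $[L_x,L_y]$. The inner structure algebra is the Lie subsuperalgebra $\mathfrak{istr}(V)=\{L_x\mid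 x\in V\}+\mathrm{Inn}(V)\subset\mathfrak{gl}(V)$. Set $D_{x,y}=2L_{xy}+2[L_x,L_y]\in\mathrm{End}(V)$. $\widetilde{\mathfrak{istr}}(V)$ is the linear span of all $D_{x,y}$, $x,y\in V$, a Lie subsuperalgebra of $\mathfrak{gl}(V)$. $\mathrm{Inn}(V,V)$ is the linear span in $\mathfrak{gl}(V)\oplus\mathfrak{gl}(V)$ of the elements $(D_{x,y},-(-1)^{|x||y|}D_{y,x})$, $x,y\in V$ homogeneous, which is a Lie subsuperalgebra. *)

(* Defs.v *)
From HB Require Import structures.
From mathcomp Require Import all_boot all_algebra.
From mathcomp Require Import boolp classical_sets functions.

Set Implicit Arguments.
Unset Strict Implicit.
Unset Printing Implicit Defensive.

Import GRing.Theory.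
Local Open Scope ring_scope.

(* Parities live in bool (false = even, true = odd), added with (+), so the   *)
(* sign (-1)^{|x||y|} is (-1) ^+ (i && j) for x of parity i and y of parity j. *)
(* A Z/2-grading is given by its two component projections x |-> x_i; the     *)
(* homogeneous subspace V_i is the set of fixed points of the i-th one.       *)
HB.mixin Record Lmodule_isSuper (K : fieldType) V of GRing.Lmodule K V := {
  hpart : bool -> V -> V;
  hpart_linear : forall i, linear (hpart i);
  hpartK : forall i j x, hpart i (hpart j x) = if i == j then hpart j x else 0;
  hpart_sum : forall x, hpart false x + hpart true x = x
}.

#[short(type="superspaceType")]
HB.structure Definition Superspace (K : fieldType) :=
  {V of GRing.Lmodule K V & Lmodule_isSuper K V}.

HB.instance Definition _ (K : fieldType) (V : superspaceType K) (i : bool) :=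
  GRing.isLinear.Build K V V *:%R (hpart i : V -> V) (hpart_linear i).

Definition homog (K : fieldType) (V : superspaceType K) (i : bool) (x : V) :=
  hpart i x = x.

(* Not assumed associative, commutative or unital. *)
HB.mixin Record Superspace_isSuperalgebra (K : fieldType) A
    of Superspace K A := {
  sprod : A -> A -> A;
  sprod_linearl : forall y, linear (sprod^~ y);
  sprod_linearr : forall x, linear (sprod x);
  sprod_homog : forall (i j : bool) (x y : A),
    homog i x -> homog j y -> homog (i (+) j) (sprod x y)
}.

#[short(type="superalgType")]
HB.structure Definition Superalgebra (K : fieldType) :=
  {A of Superspace K A & Superspace_isSuperalgebra K A}.

Notation "x ** y" := (sprod x y) (at level 40, left associativity) : ring_scope.

HB.mixin Record Superalgebra_isLie (K : fieldType) A of Superalgebra K A := {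
  sprod_superanti : forall (i j : bool) (x y : A), homog i x -> homog j y ->
    x ** y = - ((-1) ^+ (i && j) *: (y ** x));
  sprod_superjacobi : forall (i j k : bool) (x y z : A),
    homog i x -> homog j y -> homog k z ->
    x ** (y ** z) = (x ** y) ** z + (-1) ^+ (i && j) *: (y ** (x ** z))
}.

#[short(type="lieSuperalgType")]
HB.structure Definition LieSuperalgebra (K : fieldType) :=
  {A of Superalgebra K A & Superalgebra_isLie K A}.

Section SuperspaceTheory.
Variables (K : fieldType) (V : superspaceType K).
Implicit Types (i j : bool) (x : V).

Lemma homog_hpart i x : homog i (hpart i x).
Proof. by rewrite /homog hpartK eqxx. Qed.

Lemma homogE i j x : homog j x -> hpart i x = if i == j then x else 0.
Proof. by move=> hx; rewrite -{1}hx hpartK hx. Qed.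

Lemma hpart_sumb i x : hpart i x + hpart (~~ i) x = x.
Proof. by case: i; rewrite ?hpart_sum // addrC hpart_sum. Qed.

End SuperspaceTheory.

Definition gl (K : fieldType) (V : superspaceType K) : Type := {linear V -> V}.

Section GlSpace.
Variables (K : fieldType) (V : superspaceType K).

Definition gl_fun (A : gl V) : V -> V := A.

HB.instance Definition _ (A : gl V) :=
  GRing.isLinear.Build K V V *:%R (gl_fun A) (linearP A).

End GlSpace.

Coercion gl_fun : gl >-> Funclass.

Section GlLmod.
Variables (K : fieldType) (V : superspaceType K).
Implicit Types A B C : gl V.

Lemma glP A B : (forall x, A x = B x) -> A = B.
Proof.
rewrite /gl_fun; case: A B => [f [[fa] [fl]]] [g [[ga] [gl']]] /= /funext eq_fg.
case: g / eq_fg ga gl' => ga gl'; congr (GRing.Linear.Pack (GRing.Linear.Class _ _));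
  [congr GRing.isNmodMorphism.Axioms_ | congr GRing.isScalable.Axioms_];
  exact: Prop_irrelevance.
Qed.

HB.instance Definition _ := gen_eqMixin (gl V).
HB.instance Definition _ := gen_choiceMixin (gl V).

Definition gl_zero : gl V := (\0 : {linear V -> V}).
Definition gl_add A B : gl V := (gl_fun A \+ gl_fun B : {linear V -> V}).
Definition gl_opp A : gl V := (\- gl_fun A : {linear V -> V}).
Definition gl_scale (a : K) A : gl V := (a \*: gl_fun A : {linear V -> V}).
Definition gl_comp A B : gl V := (gl_fun A \o gl_fun B : {linear V -> V}).

Fact gl_addA : associative gl_add.
Proof. by move=> A B C; apply: glP => x; apply: addrA. Qed.
Fact gl_addC : commutative gl_add.
Proof. by move=> A B; apply: glP => x; apply: addrC. Qed.
Fact gl_add0 : left_id gl_zero gl_add.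
Proof. by move=> A; apply: glP => x; apply: add0r. Qed.
Fact gl_addN : left_inverse gl_zero gl_opp gl_add.
Proof. by move=> A; apply: glP => x; apply: addNr. Qed.

HB.instance Definition _ :=
  GRing.isZmodule.Build (gl V) gl_addA gl_addC gl_add0 gl_addN.

Fact gl_scaleA a b A : gl_scale a (gl_scale b A) = gl_scale (a * b) A.
Proof. by apply: glP => x; apply: scalerA. Qed.
Fact gl_scale1 : left_id 1 gl_scale.
Proof. by move=> A; apply: glP => x; apply: scale1r. Qed.
Fact gl_scaleDr : right_distributive gl_scale +%R.
Proof. by move=> a A B; apply: glP => x; apply: scalerDr. Qed.
Fact gl_scaleDl A : {morph gl_scale^~ A : a b / a + b}.
Proof. by move=> a b; apply: glP => x; apply: scalerDl. Qed.

HB.instance Definition _ := GRing.Zmodule_isLmodule.Build K (gl V)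
  gl_scaleA gl_scale1 gl_scaleDr gl_scaleDl.

Lemma gl0E x : (0 : gl V) x = 0. Proof. by []. Qed.
Lemma glDE A B x : (A + B) x = A x + B x. Proof. by []. Qed.
Lemma glNE A x : (- A) x = - A x. Proof. by []. Qed.
Lemma glZE a A x : (a *: A) x = a *: A x. Proof. by []. Qed.
Lemma gl_compE A B x : gl_comp A B x = A (B x). Proof. by []. Qed.

Definition gl_proj (i : bool) : gl V := (hpart i : {linear V -> V}).

(* Component of degree i of A: it maps V_j to V_{i+j} for both j. *)
Definition gl_part (i : bool) A : gl V :=
  gl_comp (gl_proj i) (gl_comp A (gl_proj false)) +
  gl_comp (gl_proj (~~ i)) (gl_comp A (gl_proj true)).

Lemma gl_partE i A x :
  gl_part i A x = hpart i (A (hpart false x)) + hpart (~~ i) (A (hpart true x)).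
Proof. by []. Qed.

Fact gl_part_linear i : linear (gl_part i).
Proof.
move=> a A B; apply: glP => x; rewrite [RHS]glDE glZE !gl_partE.
rewrite !(glDE (a *: A)) !glZE !linearP scalerDr.
by rewrite addrACA.
Qed.

Fact gl_partK i j A : gl_part i (gl_part j A) = if i == j then gl_part j A else 0.
Proof.
apply: glP => x; rewrite gl_partE !gl_partE !hpartK /= !linear0 !(addr0, add0r).
rewrite !hpartK eqb_negLR negbK; case: eqP => // _.
by rewrite gl0E addr0.
Qed.

Fact gl_part_sum A : gl_part false A + gl_part true A = A.
Proof.
apply: glP => x; rewrite glDE !gl_partE addrACA /= hpart_sum.
by rewrite [X in _ + X]addrC hpart_sum -linearD hpart_sum.
Qed.

HB.instance Definition _ :=
  Lmodule_isSuper.Build K (gl V) gl_part_linear gl_partK gl_part_sum.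

Lemma gl_homogP i A :
  homog i A <-> forall (j : bool) (x : V), homog j x -> homog (i (+) j) (A x).
Proof.
rewrite {1}/homog; split=> [<- j x hx | hA].
  rewrite [hpart i A]/(gl_part i A) gl_partE !(homogE _ hx).
  case: j hx => hx /=; rewrite !linear0 ?addr0 ?add0r ?addbT ?addbF;
    exact: homog_hpart.
apply: glP => x; rewrite [hpart i A]/(gl_part i A) gl_partE.
have := hA false _ (homog_hpart false x); rewrite /homog addbF => ->.
have := hA true _ (homog_hpart true x); rewrite /homog addbT => ->.
by rewrite -linearD hpart_sum.
Qed.

(* The supercommutator AB - (-1)^{|A||B|}BA, extended bilinearly from         *)
(* homogeneous elements; see scomm_homog.                                     *)
Definition hcomm (i j : bool) A B : gl V :=
  gl_comp A B - (-1) ^+ (i && j) *: gl_comp B A.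

Definition scomm A B : gl V :=
  \sum_(i : bool) \sum_(j : bool) hcomm i j (hpart i A) (hpart j B).

Lemma hcomm_linearl i j B : linear ((hcomm i j)^~ B).
Proof.
move=> a A A'; apply: glP => x; rewrite /hcomm !(glDE, glNE, glZE, gl_compE).
rewrite linearP !scalerBr !scalerDr !scalerA mulrC [in RHS]addrACA opprD.
by [].
Qed.

Lemma hcomm_linearr i j A : linear (hcomm i j A).
Proof.
move=> a B B'; apply: glP => x; rewrite /hcomm !(glDE, glNE, glZE, gl_compE).
rewrite linearP !scalerBr !scalerDr !scalerA mulrC [in RHS]addrACA opprD.
by [].
Qed.

Lemma hcomm0l i j B : hcomm i j 0 B = 0.
Proof. by have := hcomm_linearl i j B (-1) 0 0; rewrite !scaleN1r !addNr. Qed.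

Lemma hcomm0r i j A : hcomm i j A 0 = 0.
Proof. by have := hcomm_linearr i j A (-1) 0 0; rewrite !scaleN1r !addNr. Qed.

Lemma scomm_homog i j A B : homog i A -> homog j B ->
  scomm A B = gl_comp A B - (-1) ^+ (i && j) *: gl_comp B A.
Proof.
move=> hA hB; rewrite /scomm (bigD1 i) //= (bigD1 j) //= hA hB.
rewrite !big1 ?addr0 // => [k /negPf ki | k /negPf kj].
  by rewrite big1 // => l _; rewrite (homogE k hA) ki hcomm0l.
by rewrite (homogE k hB) kj hcomm0r.
Qed.

Fact scomm_linearl B : linear (scomm^~ B).
Proof.
move=> a A A'; rewrite /scomm scaler_sumr -big_split; apply: eq_bigr => i _.
rewrite scaler_sumr -big_split; apply: eq_bigr => j _.
by rewrite linearP hcomm_linearl.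
Qed.

Fact scomm_linearr A : linear (scomm A).
Proof.
move=> a B B'; rewrite /scomm scaler_sumr -big_split; apply: eq_bigr => i _.
rewrite scaler_sumr -big_split; apply: eq_bigr => j _.
by rewrite linearP hcomm_linearr.
Qed.

Lemma gl_comp_homog i j A B :
  homog i A -> homog j B -> homog (i (+) j) (gl_comp A B).
Proof.
move=> /gl_homogP hA /gl_homogP hB; apply/gl_homogP => k x hx.
by rewrite gl_compE -addbA; apply/hA/hB.
Qed.

Fact scomm_degree i j A B :
  homog i A -> homog j B -> homog (i (+) j) (scomm A B).
Proof.
move=> hA hB; rewrite (scomm_homog hA hB) /homog linearB linearZ /=.
by rewrite (gl_comp_homog hA hB) addbC (gl_comp_homog hB hA).
Qed.

HB.instance Definition _ := Superspace_isSuperalgebra.Build K (gl V)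
  scomm_linearl scomm_linearr scomm_degree.

Lemma sprod_gl A B : A ** B = scomm A B. Proof. by []. Qed.

Fact gl_superanti i j A B : homog i A -> homog j B ->
  A ** B = - ((-1) ^+ (i && j) *: (B ** A)).
Proof.
move=> hA hB; rewrite !sprod_gl (scomm_homog hA hB) (scomm_homog hB hA).
by rewrite scalerBr scalerA andbC -signr_addb addbb scale1r opprB.
Qed.

Fact gl_superjacobi i j k A B C : homog i A -> homog j B -> homog k C ->
  A ** (B ** C) = (A ** B) ** C + (-1) ^+ (i && j) *: (B ** (A ** C)).
Proof.
move=> hA hB hC; rewrite !sprod_gl.
rewrite (scomm_homog hA (scomm_degree hB hC)).
rewrite (scomm_homog (scomm_degree hA hB) hC).
rewrite (scomm_homog hB (scomm_degree hA hC)).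
rewrite (scomm_homog hB hC) (scomm_homog hA hB) (scomm_homog hA hC).
have jac6 (U : zmodType) (a b c d e f : U) :
  a - b + (- c + d) = (a - e) + (- f + d) + ((e - c) + (- b + f)).
  rewrite [RHS]addrACA subrKA [- f + d]addrC [- b + f]addrC subrKA.
  by rewrite [- c + d]addrC addrACA [RHS]addrACA [- b - c]addrC.
apply: glP => x; rewrite !(glDE, glNE, glZE, gl_compE) !linearB !linearZ /=.
rewrite !(scalerN, opprK, scalerA) andb_addl !andb_addr !signr_addb.
rewrite [j && i]andbC !mulrA -!expr2 !sqrr_sign !mul1r.
rewrite [_ * _ * (-1) ^+ (i && j)]mulrC !mulrA.
rewrite [(-1) ^+ (j && k) * (-1) ^+ (i && k)]mulrC.
exact: jac6.
Qed.

HB.instance Definition _ :=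
  Superalgebra_isLie.Build K (gl V) gl_superanti gl_superjacobi.

End GlLmod.

Section DirectSum.
Variables (K : fieldType) (A B : lieSuperalgType K).
Implicit Types (i j k : bool) (u v w : A * B).

Definition pair_part i u : A * B := (hpart i u.1, hpart i u.2).

Fact pair_part_linear i : linear (pair_part i).
Proof. by move=> a u v; rewrite /pair_part /= !linearP. Qed.

Fact pair_partK i j u :
  pair_part i (pair_part j u) = if i == j then pair_part j u else 0.
Proof. by rewrite /pair_part /= !hpartK; case: eqP. Qed.

Fact pair_part_sum u : pair_part false u + pair_part true u = u.
Proof. by case: u => x y; congr pair; exact: hpart_sum. Qed.

HB.instance Definition _ := Lmodule_isSuper.Build K (A * B)%type
  pair_part_linear pair_partK pair_part_sum.

Lemma pair_homogP i u : homog i u <-> homog i u.1 /\ homog i u.2.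
Proof.
rewrite {1}/homog [hpart i u]/(pair_part i u) /pair_part.
by case: u => x y /=; split=> [[hx hy] | [hx hy]]; [split | congr pair].
Qed.

Definition pair_prod u v : A * B := (u.1 ** v.1, u.2 ** v.2).

Fact pair_prod_linearl v : linear (pair_prod^~ v).
Proof. by move=> a u w; rewrite /pair_prod /= !sprod_linearl. Qed.

Fact pair_prod_linearr u : linear (pair_prod u).
Proof. by move=> a v w; rewrite /pair_prod /= !sprod_linearr. Qed.

Fact pair_prod_homog i j u v :
  homog i u -> homog j v -> homog (i (+) j) (pair_prod u v).
Proof.
move=> /pair_homogP[? ?] /pair_homogP[? ?].
by apply/pair_homogP; split; apply: sprod_homog.
Qed.

HB.instance Definition _ := Superspace_isSuperalgebra.Build K (A * B)%type
  pair_prod_linearl pair_prod_linearr pair_prod_homog.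

Fact pair_superanti i j u v : homog i u -> homog j v ->
  u ** v = - ((-1) ^+ (i && j) *: (v ** u)).
Proof.
move=> /pair_homogP[? ?] /pair_homogP[? ?].
by congr pair; apply: sprod_superanti.
Qed.

Fact pair_superjacobi i j k u v w : homog i u -> homog j v -> homog k w ->
  u ** (v ** w) = (u ** v) ** w + (-1) ^+ (i && j) *: (v ** (u ** w)).
Proof.
move=> /pair_homogP[? ?] /pair_homogP[? ?] /pair_homogP[? ?].
by congr pair; apply: sprod_superjacobi; eassumption.
Qed.

HB.instance Definition _ := Superalgebra_isLie.Build K (A * B)%type
  pair_superanti pair_superjacobi.

End DirectSum.

Section Subalgebras.
Variable K : fieldType.

Definition span (U : lmodType K) (S : set U) : set U :=
  [set x | exists n (a : 'I_n -> K) (u : 'I_n -> U),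
    (forall i, S (u i)) /\ x = \sum_(i < n) a i *: u i].

Definition subsuperalgebra (A : superalgType K) (S : set A) : Prop :=
  [/\ S 0,
      forall (a : K) (x y : A), S x -> S y -> S (a *: x + y),
      forall (i : bool) (x : A), S x -> S (hpart i x) &
      forall x y : A, S x -> S y -> S (x ** y)].

(* The values of f outside S are irrelevant. *)
Definition lie_isog (A B : lieSuperalgType K) (S : set A) (T : set B) : Prop :=
  [/\ subsuperalgebra S, subsuperalgebra T &
      exists f : A -> B,
      [/\ set_bij S T f,
          forall (a : K) (x y : A), S x -> S y -> f (a *: x + y) = a *: f x + f y,
          forall (i : bool) (x : A), S x -> homog i x -> homog i (f x) &
          forall x y : A, S x -> S y -> f (x ** y) = f x ** f y]].

End Subalgebras.

Section LeftMultiplication.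
Variables (K : fieldType) (V : superalgType K).

HB.instance Definition _ (x : V) :=
  GRing.isLinear.Build K V V *:%R (sprod x : V -> V) (sprod_linearr x).

Definition Lop (x : V) : gl V := (sprod x : {linear V -> V}).

End LeftMultiplication.

HB.mixin Record Superalgebra_isJordan (K : fieldType) V of Superalgebra K V := {
  sprod_superC : forall (i j : bool) (x y : V), homog i x -> homog j y ->
    x ** y = (-1) ^+ (i && j) *: (y ** x);
  sprod_jordan : forall (i j k : bool) (x y z : V),
    homog i x -> homog j y -> homog k z ->
    (-1) ^+ (i && k) *: scomm (Lop x) (Lop (y ** z)) +
    (-1) ^+ (j && i) *: scomm (Lop y) (Lop (z ** x)) +
    (-1) ^+ (k && j) *: scomm (Lop z) (Lop (x ** y)) = 0
}.

#[short(type="jordanSuperalgType")]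
HB.structure Definition JordanSuperalgebra (K : fieldType) :=
  {V of Superalgebra K V & Superalgebra_isJordan K V}.

Section JordanDefs.
Variables (K : fieldType) (V : jordanSuperalgType K).

Definition unital : Prop := exists e : V, forall x : V, e ** x = x /\ x ** e = x.

Definition hderivation (d : bool) (D : gl V) : Prop :=
  homog d D /\
  forall (i : bool) (x y : V), homog i x ->
    D (x ** y) = D x ** y + (-1) ^+ (i && d) *: (x ** D y).

Definition Der : set (gl V) := span [set D | exists d, hderivation d D].

Definition Inn : set (gl V) := span [set C | exists x y, C = scomm (Lop x) (Lop y)].

Definition istr : set (gl V) :=
  [set A | exists x, exists2 C, Inn C & A = Lop x + C].

Definition Dop (x y : V) : gl V := 2 *: Lop (x ** y) + 2 *: scomm (Lop x) (Lop y).

(* istr with a tilde: the span of the operators D_{x,y}. *)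
Definition tistr : set (gl V) := span [set A | exists x y, A = Dop x y].

(* Inn(V,V) *)
Definition Inn2 : set (gl V * gl V)%type :=
  span [set P | exists i j x y, [/\ homog i x, homog j y &
    P = (Dop x y, - ((-1) ^+ (i && j) *: Dop y x))]].

End JordanDefs.

Arguments unital {K} V.
Arguments Der {K} V.
Arguments Inn {K} V.
Arguments istr {K} V.
Arguments tistr {K} V.
Arguments Inn2 {K} V.

(* Main.v *)
From HB Require Import structures.
From mathcomp Require Import all_boot all_algebra.
From mathcomp Require Import boolp classical_sets functions.
Require Import Defs.

(** Write L_x for [Lop x] and V^2 for the span of all products. The defining
identity of a Jordan superalgebra, evaluated at a fourth element, can be
arranged so that its right hand side is supersymmetric in the four arguments
([jordan_linearized]). Comparing two instances with two arguments exchanged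
shows that [L_x, L_y] is a superderivation ([scomm_Lop_derivation]). Hence
[C, L_u] = L_{C u} for every inner C, with C u in V^2, so that the operators
L_u + C, with C inner and u in a graded subspace U containing V^2, form a Lie
subsuperalgebra ([subsuperalgebra_istr_on]).

For homogeneous x, y one has (-1)^{|x||y|} D_{y,x} = 2 L_{xy} - 2 [L_x, L_y].
Since 2 is invertible, the sums and differences of D_{x,y} and
(-1)^{|x||y|} D_{y,x} give 4 L_{xy} and 4 [L_x, L_y], so the span of the D_{x,y}
consists exactly of the L_u + C with u in V^2 and C inner ([tistrE]). If V is
unital then V^2 = V, and this is the inner structure algebra itself.

If no nonzero x has L_x in Der(V), the decomposition A = L_u + C is unique,
because Inn(V) is contained in Der(V). The map sending L_u + C to C - L_u
([twist]) is then well defined. It preserves brackets, because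
[L_u + C, L_v + D] has left multiplication part [L_u, D] + [C, L_v], odd under
the sign change, and inner part [L_u, L_v] + [C, D], even under it
([istr_sprod]). It sends D_{x,y} to -(-1)^{|x||y|} D_{y,x}; therefore
Inn(V,V) is the graph of its restriction to the span of the D_{x,y}, and
A |-> (A, [twist] A) is the isomorphism. *)

Set Implicit Arguments.
Unset Strict Implicit.
Unset Printing Implicit Defensive.

Import GRing.Theory.
Local Open Scope ring_scope.

(** * Linear subspaces and spans *)

Section Subspaces.
Variable K : fieldType.

(** Linear subspaces as classical sets, since membership in a span is not
decidable. *)
Definition subspace (U : lmodType K) (S : set U) : Prop :=
  S 0 /\ forall (a : K) x y, S x -> S y -> S (a *: x + y).

Section Closure.
Variables (U : lmodType K) (S : set U).
Hypothesis subS : subspace S.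

Lemma subspaceD x y : S x -> S y -> S (x + y).
Proof. by case: subS => _ SP Sx Sy; rewrite -[x]scale1r; apply: SP. Qed.

Lemma subspaceZ a x : S x -> S (a *: x).
Proof. by case: subS => S0 SP Sx; rewrite -[_ *: _]addr0; apply: SP. Qed.

Lemma subspaceN x : S x -> S (- x).
Proof. by rewrite -scaleN1r; apply: subspaceZ. Qed.

Lemma subspaceB x y : S x -> S y -> S (x - y).
Proof. by move=> Sx Sy; apply: subspaceD => //; apply: subspaceN. Qed.

Lemma subspace_sum (I : Type) (r : seq I) (F : I -> U) :
  (forall i, S (F i)) -> S (\sum_(i <- r) F i).
Proof.
move=> SF; elim/big_rec: _ => [|i x _ Sx]; first by case: subS.
exact: subspaceD.
Qed.

End Closure.

Lemma sub_span (U : lmodType K) (S : set U) x : S x -> span S x.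
Proof.
move=> Sx; exists 1%N, (fun=> 1), (fun=> x); split=> //.
by rewrite big_ord1 scale1r.
Qed.

Lemma subspace_span (U : lmodType K) (S : set U) : subspace (span S).
Proof.
split; first by exists 0%N, (fun=> 0), (fun=> 0); split=> [[]//|]; rewrite big_ord0.
move=> a _ _ [m [b [u [Su ->]]]] [n [c [v [Sv ->]]]].
exists (m + n)%N.
exists (fun i => match fintype.split i with inl k => a * b k | inr k => c k end).
exists (fun i => match fintype.split i with inl k => u k | inr k => v k end).
split=> [i|]; first by case: (fintype.split i).
rewrite big_split_ord scaler_sumr; congr (_ + _); apply: eq_bigr => i _.
  by rewrite (unsplitK (inl i)) scalerA.
by rewrite (unsplitK (inr i)).
Qed.

Lemma span_subset (U : lmodType K) (S T : set U) :
  subspace T -> (forall x, S x -> T x) -> forall x, span S x -> T x.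
Proof.
move=> subT ST x [n [a [u [Su ->]]]]; apply: subspace_sum => // i.
by apply: subspaceZ => //; apply: ST.
Qed.

End Subspaces.

(** * Gradings and products *)

Section Graded.
Variable K : fieldType.

(** Subsets containing the homogeneous components of their elements. *)
Definition graded (U : superspaceType K) (S : set U) : Prop :=
  forall i x, S x -> S (hpart i x).

(** A degree-preserving linear map commutes with the component projections; it
needs to be linear only on a graded subset. *)
Lemma hpart_morph (U W : superspaceType K) (S : set U) (f : U -> W) :
    graded S ->
    (forall (a : K) x y, S x -> S y -> f (a *: x + y) = a *: f x + f y) ->
    (forall i x, S x -> homog i x -> homog i (f x)) ->
  forall i x, S x -> hpart i (f x) = f (hpart i x).
Proof.
move=> grS lf hf i x Sx.
have -> : f x = f (hpart i x) + f (hpart (~~ i) x).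
  have := lf 1 _ _ (grS i _ Sx) (grS (~~ i) _ Sx).
  by rewrite !scale1r hpart_sumb.
rewrite linearD /= (hf _ _ (grS _ _ Sx) (homog_hpart _ _)).
rewrite (homogE _ (hf _ _ (grS _ _ Sx) (homog_hpart (~~ i) _))).
by rewrite (_ : (i == ~~ i) = false) ?addr0 //; case: (i).
Qed.

Section Products.
Variable A : superalgType K.
Implicit Types x y z : A.

Lemma sprodDl x y z : (x + y) ** z = x ** z + y ** z.
Proof. by have := sprod_linearl z 1 x y; rewrite !scale1r. Qed.

Lemma sprodZl a x z : (a *: x) ** z = a *: (x ** z).
Proof.
have s0 : (0 : A) ** z = 0.
  by have := sprod_linearl z (-1) 0 0; rewrite !scaleN1r !addNr.
by have := sprod_linearl z a x 0; rewrite s0 !addr0.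
Qed.

Lemma sprodNl x z : (- x) ** z = - (x ** z).
Proof. by rewrite -scaleN1r sprodZl scaleN1r. Qed.

Lemma sprodBl x y z : (x - y) ** z = x ** z - y ** z.
Proof. by rewrite sprodDl sprodNl. Qed.

Lemma sprodDr x y z : z ** (x + y) = z ** x + z ** y.
Proof. exact: linearD. Qed.

Lemma sprodZr a x z : z ** (a *: x) = a *: (z ** x).
Proof. exact: linearZ. Qed.

Lemma sprodBr x y z : z ** (x - y) = z ** x - z ** y.
Proof. exact: linearB. Qed.

Lemma sprod_hparts x y : x ** y =
  (hpart false x ** hpart false y + hpart false x ** hpart true y) +
  (hpart true x ** hpart false y + hpart true x ** hpart true y).
Proof. by rewrite -!sprodDr -sprodDl !hpart_sum. Qed.

End Products.
End Graded.

(** * Inner derivations of a Jordan superalgebra *)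

Section Jordan.
Variables (K : fieldType) (V : jordanSuperalgType K).
Implicit Types (x y z w : V) (A B C D : gl V).

Lemma Lop_linear : linear (@Lop K V).
Proof. by move=> a x y; apply: glP => z; exact: sprod_linearl. Qed.

HB.instance Definition _ :=
  GRing.isLinear.Build K V (gl V) *:%R (@Lop K V) Lop_linear.

Lemma LopE x y : Lop x y = x ** y. Proof. by []. Qed.

Lemma Lop_homog i x : homog i x -> homog i (Lop x).
Proof. by move=> hx; apply/gl_homogP => j y hy; exact: sprod_homog. Qed.

Lemma Lop_hpart i x : hpart i (Lop x) = Lop (hpart i x).
Proof.
apply: (@hpart_morph _ _ _ setT) => // [a y z _ _|j y _]; first exact: Lop_linear.
exact: Lop_homog.
Qed.

Lemma scomm_LopE i j x y z : homog i x -> homog j y ->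
  scomm (Lop x) (Lop y) z = x ** (y ** z) - (-1) ^+ (i && j) *: (y ** (x ** z)).
Proof.
by move=> hx hy; rewrite (scomm_homog (Lop_homog hx) (Lop_homog hy)).
Qed.

(** The Jordan identity for [x], [y], [z] evaluated at [w], with every term
rewritten by supercommutativity. The right hand side is, up to the sign
[(-1) ^+ (i && l)], invariant under exchanging [x] and [w]. *)
Lemma jordan_linearized i j k l x w z y :
    homog i x -> homog l w -> homog k z -> homog j y ->
  x ** (w ** (z ** y)) + (-1) ^+ (i && l) *: ((w ** (x ** z)) ** y) +
    (-1) ^+ ((i && l) (+) (i && k) (+) (l && k)) *: (z ** (w ** (x ** y))) =
  (x ** w) ** (z ** y) + (-1) ^+ (l && k) *: ((x ** z) ** (w ** y)) +
    (-1) ^+ (i && (l (+) k)) *: ((w ** z) ** (x ** y)).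
Proof.
move=> hx hw hz hy.
have := congr1 (fun A : gl V => A w) (sprod_jordan _ _ _ _ _ _ hx hy hz).
rewrite !(glDE, glZE, gl0E).
rewrite (scomm_LopE _ hx (sprod_homog _ _ _ _ hy hz)).
rewrite (scomm_LopE _ hy (sprod_homog _ _ _ _ hz hx)).
rewrite (scomm_LopE _ hz (sprod_homog _ _ _ _ hx hy)).
(* [e] makes the coefficient of [x ** (w ** (z ** y))] equal to 1. *)
pose e : K := (-1) ^+ ((i && k) (+) (j && k) (+) (l && (j (+) k))).
move=> /(congr1 (fun v => e *: v)) /eqP; rewrite scaler0 !(scalerDr, scalerN).
rewrite [_ - _ + (_ - _)]addrACA -opprD addrACA -opprD subr_eq0 => /eqP.
have sC := @sprod_superC K V; have hM := @sprod_homog K V.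
have -> : (y ** z) ** w = (-1) ^+ ((j && k) (+) (l && (j (+) k))) *: (w ** (z ** y)).
  rewrite (sC _ _ _ _ (hM _ _ _ _ hy hz) hw) (sC _ _ _ _ hy hz) sprodZr scalerA.
  by rewrite -signr_addb; congr (_ ^+ _ *: _); case: (i) (j) (k) (l) => [] [] [] [].
have -> : y ** ((z ** x) ** w) =
    (-1) ^+ ((i && k) (+) (l && (k (+) i)) (+) (j && (k (+) (i (+) l)))) *:
      ((w ** (x ** z)) ** y).
  rewrite (sC _ _ _ _ (hM _ _ _ _ hz hx) hw) (sC _ _ _ _ hz hx) !sprodZr.
  rewrite (sC _ _ _ _ hy (hM _ _ _ _ hw (hM _ _ _ _ hx hz))) !scalerA.
  by rewrite -!signr_addb; congr (_ ^+ _ *: _); case: (i) (j) (k) (l) => [] [] [] [].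
have -> : (x ** y) ** w = (-1) ^+ (l && (i (+) j)) *: (w ** (x ** y)).
  rewrite (sC _ _ _ _ (hM _ _ _ _ hx hy) hw).
  by congr (_ ^+ _ *: _); case: (i) (j) (k) (l) => [] [] [] [].
have -> : (y ** z) ** (x ** w) =
    (-1) ^+ ((j && k) (+) ((j (+) k) && (i (+) l))) *: ((x ** w) ** (z ** y)).
  rewrite (sC _ _ _ _ (hM _ _ _ _ hy hz) (hM _ _ _ _ hx hw)).
  rewrite (sC _ _ _ _ hy hz) !sprodZr scalerA.
  by rewrite -signr_addb; congr (_ ^+ _ *: _); case: (i) (j) (k) (l) => [] [] [] [].
have -> : (z ** x) ** (y ** w) =
    (-1) ^+ ((i && k) (+) (j && l)) *: ((x ** z) ** (w ** y)).
  rewrite (sC _ _ _ _ hz hx) (sC _ _ _ _ hy hw) sprodZl sprodZr scalerA.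
  by rewrite -signr_addb; congr (_ ^+ _ *: _); case: (i) (j) (k) (l) => [] [] [] [].
have -> : (x ** y) ** (z ** w) =
    (-1) ^+ ((k && l) (+) ((i (+) j) && (k (+) l))) *: ((w ** z) ** (x ** y)).
  rewrite (sC _ _ _ _ (hM _ _ _ _ hx hy) (hM _ _ _ _ hz hw)).
  rewrite (sC _ _ _ _ hz hw) sprodZl scalerA.
  by rewrite -signr_addb; congr (_ ^+ _ *: _); case: (i) (j) (k) (l) => [] [] [] [].
rewrite !sprodZr !scalerA /e -!signr_addb => J.
(* Both sides now agree with [J] term by term, up to the value of the signs. *)
apply: etrans (etrans _ J) _.
  by case: (i) (j) (k) (l) => [] [] [] []; rewrite /= ?expr0 ?scale1r.
by case: (i) (j) (k) (l) => [] [] [] []; rewrite /= ?expr0 ?scale1r.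
Qed.

Lemma scomm_Lop_derivation i j x y :
  homog i x -> homog j y -> hderivation (i (+) j) (scomm (Lop x) (Lop y)).
Proof.
move=> hx hy; split; first exact: scomm_degree (Lop_homog hx) (Lop_homog hy).
move=> k z w hz.
suff leibniz l v : homog l v -> scomm (Lop x) (Lop y) (z ** v) =
    scomm (Lop x) (Lop y) z ** v +
    (-1) ^+ (k && (i (+) j)) *: (z ** scomm (Lop x) (Lop y) v).
  rewrite -(hpart_sum w) !linearD /= (leibniz _ _ (homog_hpart false w)).
  by rewrite (leibniz _ _ (homog_hpart true w)) addrACA.
move=> hv; rewrite !(scomm_LopE _ hx hy).
set s : K := (-1) ^+ (i && j).
have sym : x ** (y ** (z ** v)) + s *: ((y ** (x ** z)) ** v) +
      (-1) ^+ (k && (i (+) j)) *: (s *: (z ** (y ** (x ** v)))) =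
    s *: (y ** (x ** (z ** v))) + (x ** (y ** z)) ** v +
      (-1) ^+ (k && (i (+) j)) *: (z ** (x ** (y ** v))).
  (* [JA] and [JB] have the same right hand side up to the sign [s], so their
     left hand sides agree up to [s]. *)
  have JA := jordan_linearized hx hy hz hv; have JB := jordan_linearized hy hx hz hv.
  refine (etrans (etrans _ JA) (etrans _ (etrans (esym (congr1 ( *:%R s) JB)) _))).
  - rewrite !scalerA /s -!signr_addb; congr (_ + _ ^+ _ *: _).
    by case: (i) (j) (k) => [] [] [].
  - rewrite [LHS]addrAC !scalerDr !scalerA /s -!signr_addb.
    rewrite (sprod_superC _ _ _ _ hx hy) sprodZl.
    by congr (_ + _ ^+ _ *: _ + _ ^+ _ *: _); case: (i) (j) (k) => [] [] [].
  rewrite !scalerDr !scalerA /s -!signr_addb.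
  by case: (i) (j) (k) => [] [] []; rewrite /= ?expr0 ?scale1r.
rewrite sprodBl sprodBr scalerBr sprodZl sprodZr.
set a := x ** _ in sym *; set b := s *: _ in sym *.
set c := (-1) ^+ _ *: (s *: _) in sym *.
have -> : a = a + b + c - c - b by rewrite !addrK.
rewrite sym addrC -!addrA addKr; congr (_ + _).
by rewrite [RHS]addrC -addrA.
Qed.

(** * The algebras of operators L_u + C *)

(** The linear span of all products in [V]. *)
Definition sqr : set V := span [set u | exists x y, u = x ** y].

(** The operators [Lop u + C] with [u] in [U] and [C] inner; [U] is taken to be
the whole of [V] or [sqr]. *)
Definition istr_on (U : set V) : set (gl V) :=
  [set A | exists2 u, U u & exists2 C, Inn V C & A = Lop u + C].

Lemma Lop_sprod_hparts x y : Lop x ** Lop y =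
  (Lop (hpart false x) ** Lop (hpart false y) +
   Lop (hpart false x) ** Lop (hpart true y)) +
  (Lop (hpart true x) ** Lop (hpart false y) +
   Lop (hpart true x) ** Lop (hpart true y)).
Proof. by rewrite sprod_hparts !Lop_hpart. Qed.

(** In each of the following induction principles, homogeneous generators
suffice. *)
Lemma Inn_ind (R : set (gl V)) : subspace R ->
    (forall i j x y, homog i x -> homog j y -> R (scomm (Lop x) (Lop y))) ->
  forall C, Inn V C -> R C.
Proof.
move=> subR hR; apply: span_subset => // _ [x [y ->]]; rewrite -sprod_gl Lop_sprod_hparts.
by apply: (subspaceD subR); apply: (subspaceD subR); apply: hR; exact: homog_hpart.
Qed.

Lemma sqr_ind (R : set V) : subspace R ->
    (forall i j x y, homog i x -> homog j y -> R (x ** y)) ->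
  forall u, sqr u -> R u.
Proof.
move=> subR hR; apply: span_subset => // _ [x [y ->]]; rewrite sprod_hparts.
by apply: (subspaceD subR); apply: (subspaceD subR); apply: hR; exact: homog_hpart.
Qed.

Lemma tistr_ind (R : set (gl V)) : subspace R ->
    (forall i j x y, homog i x -> homog j y -> R (Dop x y)) ->
  forall A, tistr V A -> R A.
Proof.
move=> subR hR; apply: span_subset => // _ [x [y ->]].
have -> : Dop x y =
    (Dop (hpart false x) (hpart false y) + Dop (hpart false x) (hpart true y)) +
    (Dop (hpart true x) (hpart false y) + Dop (hpart true x) (hpart true y)).
  rewrite /Dop sprod_hparts -sprod_gl Lop_sprod_hparts !linearD /=.
  by rewrite addrACA; congr (_ + _); exact: addrACA.
by apply: (subspaceD subR); apply: (subspaceD subR); apply: hR; exact: homog_hpart.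
Qed.

Lemma subspace_Inn : subspace (Inn V). Proof. exact: subspace_span. Qed.
Lemma subspace_sqr : subspace sqr. Proof. exact: subspace_span. Qed.

Lemma sqr_sprod x y : sqr (x ** y).
Proof. by apply: sub_span; exists x, y. Qed.

Lemma Inn_scomm x y : Inn V (scomm (Lop x) (Lop y)).
Proof. by apply: sub_span; exists x, y. Qed.

Lemma Inn_Der C : Inn V C -> Der V C.
Proof.
apply: Inn_ind => [|i j x y hx hy]; first exact: subspace_span.
by apply: sub_span; exists (i (+) j); apply: scomm_Lop_derivation.
Qed.

Lemma Der_Lop C y : Der V C -> C ** Lop y = Lop (C y).
Proof.
move: C; apply: span_subset.
  split=> [|a C D eC eD]; first by rewrite -(scale0r 0) sprodZl !scale0r linear0.
  by rewrite sprodDl sprodZl eC eD glDE glZE linearP.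
move=> D [d [hD leibniz]]; rewrite -(hpart_sum y) !linearD /=.
suff homog_Lop i u : homog i u -> D ** Lop u = Lop (D u).
  by congr (_ + _); apply: homog_Lop; exact: homog_hpart.
move=> hu; rewrite sprod_gl (scomm_homog hD (Lop_homog hu)).
apply: glP => v; rewrite glDE glNE glZE !gl_compE !LopE (leibniz _ _ _ hu).
by rewrite andbC addrK.
Qed.

Lemma graded_Inn : graded (Inn V).
Proof.
move=> i; apply: (@Inn_ind (fun C => Inn V (hpart i C))) => [|j k x y hx hy].
  split=> [|a C D IC ID]; first by rewrite linear0; case: subspace_Inn.
  by rewrite linearP; apply: (proj2 subspace_Inn).
rewrite (homogE _ (scomm_degree (Lop_homog hx) (Lop_homog hy))).
by case: ifP => _; [exact: Inn_scomm | case: subspace_Inn].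
Qed.

Lemma graded_sqr : graded sqr.
Proof.
move=> i; apply: (@sqr_ind (fun u => sqr (hpart i u))) => [|j k x y hx hy].
  split=> [|a C D IC ID]; first by rewrite linear0; case: subspace_sqr.
  by rewrite linearP; apply: (proj2 subspace_sqr).
rewrite (homogE _ (sprod_homog _ _ _ _ hx hy)).
by case: ifP => _; [exact: sqr_sprod | case: subspace_sqr].
Qed.

Lemma Inn_sqr C u : Inn V C -> sqr (C u).
Proof.
move: C; apply: Inn_ind => [|i j x y hx hy].
  split=> [|a C D sC sD]; first by rewrite gl0E; case: subspace_sqr.
  by rewrite glDE glZE; apply: (proj2 subspace_sqr).
rewrite (scomm_LopE _ hx hy); apply: (subspaceB subspace_sqr).
  exact: sqr_sprod.
by apply: (subspaceZ subspace_sqr); exact: sqr_sprod.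
Qed.

Lemma Inn_sprod C D : Inn V C -> Inn V D -> Inn V (C ** D).
Proof.
move=> IC; rewrite -(hpart_sum C).
suff homog_sprod i B : homog i B -> Inn V B -> forall D, Inn V D -> Inn V (B ** D).
  move=> ID; rewrite sprodDl; apply: (subspaceD subspace_Inn);
    exact: homog_sprod (homog_hpart _ _) (graded_Inn _ IC) _ ID.
move=> hB IB; apply: Inn_ind => [|j k x y hx hy].
  split=> [|a D1 D2 I1 I2]; first by rewrite linear0; case: subspace_Inn.
  by rewrite linearP; apply: (proj2 subspace_Inn).
rewrite -sprod_gl (sprod_superjacobi _ _ _ _ _ _ hB (Lop_homog hx) (Lop_homog hy)).
rewrite !(Der_Lop _ (Inn_Der IB)); apply: (subspaceD subspace_Inn).
  exact: Inn_scomm.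
by apply: (subspaceZ subspace_Inn); exact: Inn_scomm.
Qed.

(** The set of all left multiplications by elements of the square of [V]. *)
Definition Lop_sqr : set (gl V) := [set A | exists2 w, sqr w & A = Lop w].

Lemma subspace_Lop_sqr : subspace Lop_sqr.
Proof.
split; first by exists 0; [case: subspace_sqr | rewrite linear0].
move=> a _ _ [v sv ->] [w sw ->]; exists (a *: v + w); last by rewrite linearP.
exact: (proj2 subspace_sqr).
Qed.

Lemma Inn_Lop C u : Inn V C -> Lop_sqr (C ** Lop u).
Proof.
by move=> IC; exists (C u); [exact: Inn_sqr | rewrite (Der_Lop _ (Inn_Der IC))].
Qed.

Lemma Lop_Inn u C : Inn V C -> Lop_sqr (Lop u ** C).
Proof.
move=> IC; rewrite sprod_hparts !Lop_hpart.
suff homog_Lop i j : Lop_sqr (Lop (hpart i u) ** hpart j C).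
  by apply: (subspaceD subspace_Lop_sqr); apply: (subspaceD subspace_Lop_sqr).
rewrite (sprod_superanti _ _ _ _ (Lop_homog (homog_hpart i u)) (homog_hpart j C)).
apply: (subspaceN subspace_Lop_sqr); apply: (subspaceZ subspace_Lop_sqr).
exact: Inn_Lop (graded_Inn j IC).
Qed.

(** The bracket of [Lop u + C] and [Lop v + D] and that of the operators obtained
by changing the sign of the left multiplications, with the same [w] and [E]. *)
Lemma istr_sprod u v C D : Inn V C -> Inn V D ->
  exists w E, [/\ sqr w, Inn V E,
    (Lop u + C) ** (Lop v + D) = Lop w + E &
    (C - Lop u) ** (D - Lop v) = E - Lop w].
Proof.
move=> IC ID.
have [w sw ew] : Lop_sqr (Lop u ** D + C ** Lop v).
  by apply: (subspaceD subspace_Lop_sqr); [exact: Lop_Inn | exact: Inn_Lop].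
exists w, (Lop u ** Lop v + C ** D); split=> //.
- apply: (subspaceD subspace_Inn); [exact: Inn_scomm | exact: Inn_sprod].
- by rewrite sprodDl !sprodDr -ew (addrC (C ** Lop v)) addrACA addrC.
rewrite sprodBl !sprodBr -ew opprB addrACA -opprD.
by rewrite (addrC (C ** D)) (addrC (C ** Lop v)).
Qed.

Lemma subspace_istr_on U : subspace U -> subspace (istr_on U).
Proof.
move=> [U0 UP]; split.
  by exists 0 => //; exists 0; [case: subspace_Inn | rewrite linear0 addr0].
move=> a _ _ [u Uu [C IC ->]] [v Uv [D ID ->]].
exists (a *: u + v); first exact: UP.
exists (a *: C + D); first exact: (proj2 subspace_Inn).
by rewrite linearP scalerDr addrACA.
Qed.

Lemma subsuperalgebra_istr_on U : subspace U -> graded U ->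
  (forall u, sqr u -> U u) -> subsuperalgebra (istr_on U).
Proof.
move=> subU grU sqrU; have [U0 UP] := subspace_istr_on subU; split=> //.
  move=> i _ [u Uu [C IC ->]]; exists (hpart i u); first exact: grU.
  exists (hpart i C); first exact: graded_Inn.
  by rewrite linearD /= Lop_hpart.
move=> _ _ [u _ [C IC ->]] [v _ [D ID ->]].
have [w [E [sw IE -> _]]] := istr_sprod u v IC ID.
by exists w; [exact: sqrU | exists E].
Qed.

Lemma istrE : istr V = istr_on setT.
Proof.
rewrite predeqE => A; split=> [[x [C IC ->]]|[x _ [C IC ->]]].
  by exists x => //; exists C.
by exists x; exists C.
Qed.

Lemma sqr_unital : unital V -> sqr = setT.
Proof.
case=> e eP; rewrite predeqE => u; split=> // _.
by have [<- _] := eP u; exact: sqr_sprod.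
Qed.

(** * The span of the operators D_{x,y} *)

Lemma DopC i j x y : homog i x -> homog j y ->
  (-1) ^+ (i && j) *: Dop y x = 2 *: Lop (x ** y) - 2 *: scomm (Lop x) (Lop y).
Proof.
move=> hx hy; rewrite (sprod_superC _ _ _ _ hx hy) -!sprod_gl.
rewrite (sprod_superanti _ _ _ _ (Lop_homog hx) (Lop_homog hy)).
rewrite /Dop linearZ /= scalerN opprK scalerDr !scalerA.
by rewrite !(mulrC _ 2).
Qed.

Section Char2.
Hypothesis char_not2 : 2%N \notin [pchar K].

Let four_neq0 : 4%:R != 0 :> K.
Proof.
have two_neq0 : 2%:R != 0 :> K by apply: contra char_not2 => /eqP/eqP; rewrite inE.
by rewrite (natrM _ 2 2) mulf_neq0.
Qed.

Lemma tistrE : tistr V = istr_on sqr.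
Proof.
have subT : subspace (tistr V) by exact: subspace_span.
have TD x y : tistr V (Dop x y) by apply: sub_span; exists x, y.
rewrite predeqE => A; split.
  apply: span_subset; first exact: subspace_istr_on subspace_sqr.
  move=> _ [x [y ->]]; exists (2 *: (x ** y)).
    by apply: (subspaceZ subspace_sqr); exact: sqr_sprod.
  exists (2 *: scomm (Lop x) (Lop y)); last by rewrite linearZ.
  by apply: (subspaceZ subspace_Inn); exact: Inn_scomm.
move=> [u su [C IC ->]]; apply: (subspaceD subT).
  move: u su; apply: (@sqr_ind (fun u => tistr V (Lop u))).
    split=> [|a u v Tu Tv]; first by rewrite linear0; case: subT.
    by rewrite linearP; apply: (proj2 subT).
  move=> i j x y hx hy.
  have -> : Lop (x ** y) = 4^-1 *: (Dop x y + (-1) ^+ (i && j) *: Dop y x).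
    rewrite (DopC hx hy) /Dop addrACA subrr addr0 -scalerDl -natrD scalerA.
    by rewrite mulVf ?scale1r.
  by apply: (subspaceZ subT); apply: (subspaceD subT) => //; exact: subspaceZ.
move: C IC; apply: (Inn_ind subT) => i j x y hx hy.
have -> : scomm (Lop x) (Lop y) =
    4^-1 *: (Dop x y - (-1) ^+ (i && j) *: Dop y x).
  rewrite (DopC hx hy) /Dop opprB addrC subrKA -scalerDl -natrD scalerA.
  by rewrite mulVf ?scale1r.
by apply: (subspaceZ subT); apply: (subspaceB subT) => //; exact: subspaceZ.
Qed.

End Char2.

(** * The sign change on left multiplications *)

(** The map sending [Lop u + C], with [C] inner, to [C - Lop u]. It is specified
by [twistE] when [Lop x] is not a derivation for any nonzero [x], so that [u]
and [C] are determined by their sum; elsewhere its value does not matter. *)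
Definition twist A : gl V :=
  xget 0 [set B | exists u C, [/\ Inn V C, A = Lop u + C & B = C - Lop u]].

Section Twist.
Hypothesis Lop_notDer : forall x, x != 0 -> ~ Der V (Lop x).

Lemma Lop_Inn_inj u v C D : Inn V C -> Inn V D ->
  Lop u + C = Lop v + D -> u = v /\ C = D.
Proof.
move=> IC ID e.
have uv : u = v.
  apply/eqP; rewrite -subr_eq0; apply/negPn/negP => /Lop_notDer; apply.
  have -> : Lop (u - v) = D - C.
    rewrite linearB /=; apply: (addIr (Lop v + C)).
    by rewrite subrKA e (addrC (Lop v) C) subrKA addrC.
  by apply: Inn_Der; exact: subspaceB subspace_Inn _ _ ID IC.
by split=> //; move: e; rewrite uv => /addrI.
Qed.

Lemma twistE u C : Inn V C -> twist (Lop u + C) = C - Lop u.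
Proof.
move=> IC; apply: xget_unique => [|B [v [D [ID /(Lop_Inn_inj IC ID) [-> ->] ->]]]] //.
by exists u, C.
Qed.

Lemma twist_linear U : forall (a : K) A B, istr_on U A -> istr_on U B ->
  twist (a *: A + B) = a *: twist A + twist B.
Proof.
move=> a _ _ [u _ [C IC ->]] [v _ [D ID ->]]; rewrite !twistE //.
have -> : a *: (Lop u + C) + (Lop v + D) = Lop (a *: u + v) + (a *: C + D).
  by rewrite linearP scalerDr addrACA.
rewrite twistE; last exact: (proj2 subspace_Inn).
by rewrite linearP scalerBr addrACA -opprD.
Qed.

Lemma twist_homog U i A : istr_on U A -> homog i A -> homog i (twist A).
Proof.
move=> [u _ [C IC ->]] hA; rewrite -{1}hA linearD /= Lop_hpart.
rewrite twistE; last exact: graded_Inn.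
by rewrite -Lop_hpart -linearB; exact: homog_hpart.
Qed.

Lemma twist_sprod U A B : istr_on U A -> istr_on U B ->
  twist (A ** B) = twist A ** twist B.
Proof.
move=> [u _ [C IC ->]] [v _ [D ID ->]]; rewrite !twistE //.
by have [w [E [_ IE -> ->]]] := istr_sprod u v IC ID; rewrite twistE.
Qed.

Lemma twist_Dop i j x y : homog i x -> homog j y ->
  twist (Dop x y) = - ((-1) ^+ (i && j) *: Dop y x).
Proof.
move=> hx hy; rewrite (DopC hx hy) opprB /Dop -linearZ twistE ?linearZ //.
by apply: (subspaceZ subspace_Inn); exact: Inn_scomm.
Qed.

End Twist.
End Jordan.

(** * The isomorphisms *)

Lemma lie_isog_image (K : fieldType) (A B : lieSuperalgType K) (S : set A)
    (f : A -> B) :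
    subsuperalgebra S -> injective f ->
    (forall (a : K) x y, S x -> S y -> f (a *: x + y) = a *: f x + f y) ->
    (forall i x, S x -> homog i x -> homog i (f x)) ->
    (forall x y, S x -> S y -> f (x ** y) = f x ** f y) ->
  lie_isog S (f @` S).
Proof.
move=> subS injf lf hf mf; have [S0 SP Sh SM] := subS; split=> //; last first.
  exists f; split=> //; apply: inj_bij => x y _ _; exact: injf.
split.
- exists 0 => //; have := lf (-1) _ _ S0 S0.
  by rewrite scaler0 addr0 scaleN1r addNr.
- move=> a _ _ [x Sx <-] [y Sy <-].
  by exists (a *: x + y); [exact: SP | exact: lf].
- move=> i _ [x Sx <-]; exists (hpart i x); first exact: Sh.
  by rewrite (hpart_morph Sh lf hf).
- move=> _ _ [x Sx <-] [y Sy <-].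
  by exists (x ** y); [exact: SM | exact: mf].
Qed.

Theorem lemma3p17 (K : fieldType)
    (char_not2 : 2%N \notin [pchar K]) (char_not3 : 3%N \notin [pchar K])
    (V : jordanSuperalgType K) :
  ((forall x : V, x != 0 -> ~ Der V (Lop x)) -> lie_isog (tistr V) (Inn2 V)) /\
  (unital V -> lie_isog (tistr V) (istr V)).
Proof.
have subT : subsuperalgebra (tistr V).
  rewrite (tistrE V char_not2); apply: subsuperalgebra_istr_on => //.
    exact: subspace_sqr.
  exact: graded_sqr.
split=> [Lop_notDer | unitV]; last first.
  have -> : istr V = tistr V by rewrite (tistrE V char_not2) sqr_unital // istrE.
  have := @lie_isog_image K _ _ (tistr V) id subT (fun _ _ => id).
  by rewrite image_id; apply.
(* [f] is injective because its first component is the identity. *)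
pose f A : gl V * gl V := (A, twist A).
have TE := tistrE V char_not2.
have lf (a : K) A B : tistr V A -> tistr V B -> f (a *: A + B) = a *: f A + f B.
  by rewrite TE => TA TB; congr pair; exact: twist_linear TA TB.
have TD (x y : V) : tistr V (Dop x y) by apply: sub_span; exists x, y.
have -> : Inn2 V = (f @` tistr V)%classic.
  have [T0 TP _ _] := subT.
  have f0 : f 0 = 0.
    by have := lf (-1) _ _ T0 T0; rewrite scaler0 addr0 scaleN1r addNr.
  have sub2 : subspace (Inn2 V) by exact: subspace_span.
  rewrite predeqE => P; split.
    apply: span_subset.
      split; first by exists 0.
      move=> a _ _ [A TA <-] [B TB <-].
      by exists (a *: A + B); [exact: TP | exact: lf].
    move=> _ [i [j [x [y [hx hy ->]]]]]; exists (Dop x y) => //.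
    by rewrite /f (twist_Dop Lop_notDer hx hy).
  move=> [A TA <-].
  suff [] : tistr V A /\ Inn2 V (f A) by [].
  move: A TA; apply: (@tistr_ind _ _ (fun A => tistr V A /\ Inn2 V (f A))).
    split=> [|a A B [TA IA] [TB IB]]; first by rewrite f0; case: sub2.
    by split; [exact: TP | rewrite lf //; exact: (proj2 sub2)].
  move=> i j x y hx hy; split=> //; apply: sub_span.
  by exists i, j, x, y; split=> //; rewrite /f (twist_Dop Lop_notDer hx hy).
apply: lie_isog_image => //.
- by move=> A B [].
- move=> i A; rewrite TE => TA hA; apply/pair_homogP; split=> //=.
  exact: twist_homog TA hA.
- by move=> A B; rewrite TE => TA TB; congr pair; exact: twist_sprod TA TB.
Qed.
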